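(* Let $X$ be a topological space, let $\alpha:X\to X$ be an aperiodic function, and let $\mathcal F$ be a Banach function space on $X$ satisfying condition $\Omega_\alpha$. Suppose that $X$ has a compact subset $K$ with $\|\chi_K\|_{\mathcal F}>0$, and let $w$ and $\frac1w$ be weight functions on $X$. If the sequence $(C^{(n)}_{\alpha,w})_{n\in\mathbb N_0}$ is chaotic on $\mathcal F$, then $\inf_{x\in X}w(x)\le 1\le \sup_{x\in X}w(x)$.
   Context: Notation: $\mathbb N_0=\mathbb N\cup\{0\}$; $\mathcal M_0(X)$ is the set of all Borel measurable complex-valued functions on $X$; $\chi_A$ is the characteristic function of $A$. Aperiodic: a bijection $\alpha:X\to X$ with $\alpha,\alpha^{-1}$ Borel measurable is aperiodic if for each compact $K\subseteq X$ there is $N>0$ such that $K\cap\alpha^n(K)=\varnothing$ for all $n\ge N$, where $\alpha^n$ is the $n$-fold composition. Banach function space on $X$: a linear subspace $\mathcal F$ of $\mathcal M_0(X)$ equipped with a norm $\|\cdot\|_{\mathcal F}$ making it a Banach space. Standing assumption: $\mathcal F$ is separable and infinite-dimensional. Solid: if $f\in\mathcal F$, $g\in\mathcal M_0(X)$ and $|g|\le|f|$, then $g\in\mathcal F$ and $\|g\|_{\mathcal F}\le\|f\|_{\mathcal F}$. $\alpha$-invariant: for each $f\in\mathcal F$, $f\circ\alpha^{\pm1}\in\mathcal F$ and $\|f\circ\alpha^{\pm1}\|_{\mathcal F}=\|f\|_{\mathcal F}$. Condition $\Omega_\alpha$: (1) $\mathcal F$ is solid and $\alpha$-invariant; (2)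 $\chi_E\in\mathcal F$ for each compact $E\subseteq X$; (3) the set $\mathcal F_{bc}$ of all bounded compactly supported functions in $\mathcal F$ is dense in $\mathcal F$. Weight: a bounded Borel measurable function $w:X\to(0,\infty)$. For weights $w,\frac1w$, define $T_{\alpha,w}f:=w\cdot(f\circ\alpha)$ for $f\in\mathcal F$; this is a bounded invertible operator on $\mathcal F$, with inverse $S_{\alpha,w}f=\frac{f\circ\alpha^{-1}}{w\circ\alpha^{-1}}$. Put $C^{(n)}_{\alpha,w}:=\frac12(T^n_{\alpha,w}+S^n_{\alpha,w})$. A sequence $(T_n)_{n\in\mathbb N_0}$ of bounded linear operators on a Banach space $\mathcal X$ is topologically transitive if for all non-empty open $U,V\subseteq\mathcal X$ there is $n\in\mathbb N$ with $T_n(U)\cap V\ne\varnothing$. A vector $x\in\mathcal X$ is a periodic element of $(T_n)$ if there is $N\in\mathbb N$ with $T_{kN}x=x$ for all $k\in\mathbb N$; $\mathcal P((T_n)_{n\in\mathbb N_0})$ is the set of periodic elements. The sequence is chaotic if it is topologically transitive and $\mathcal P((T_n)_{n\in\mathbb N_0})$ is dense in $\mathcal X$. *)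

(* Defs.v *)
From HB Require Import structures.
From mathcomp Require Import all_boot all_order all_algebra.
From mathcomp Require Export complex.
From mathcomp Require Import all_classical all_reals all_analysis.
From mathcomp Require Import ring.

Set Implicit Arguments.
Unset Strict Implicit.
Unset Printing Implicit Defensive.

Import Order.TTheory GRing.Theory Num.Theory.
Import numFieldNormedType.Exports.

Local Open Scope classical_set_scope.
Local Open Scope ring_scope.
Local Open Scope complex_scope.

(* This is [measurable_fun setT f] for the sigma-algebras generated by the open
   sets; it is unfolded because [g_sigma_algebraType] requires a pointed type. *)
Definition borel_measurable (X Y : topologicalType) (f : X -> Y) : Prop :=
  forall B : set Y, <<s open >> B -> <<s open >> (f @^-1` B).

Section Dynamics.
Variable E : topologicalType.
Implicit Type T : nat -> E -> E.

Definition topologically_transitive T : Prop :=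
  forall U V : set E, open U -> U !=set0 -> open V -> V !=set0 ->
    exists2 n, (0 < n)%N & (T n @` U) `&` V !=set0.

Definition periodic_elements T : set E :=
  [set x | exists2 N, (0 < N)%N &
     forall k, (0 < k)%N -> T (k * N)%N x = x].

Definition chaotic T : Prop :=
  topologically_transitive T /\ dense (periodic_elements T).

Definition separable : Prop := exists2 D : set E, countable D & dense D.

End Dynamics.

Definition infinite_dimensional (K : fieldType) (V : lmodType K) : Prop :=
  ~ exists s : seq V, forall v, exists c : nat -> K,
      v = \sum_(i < size s) c i *: s`_i.

Section Spaces.
Variables (R : realType) (X : topologicalType).

(* A Banach space over C together with its inclusion into the space of Borel
   functions X -> C; functions are not identified almost everywhere.  Norms in
   a [normedModType R[i]] take their (real, nonnegative) values in R[i]. *)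
Record banachFunctionSpace := BanachFunctionSpace {
  bfs_sort :> completeNormedModType R[i];
  bfs_fun : {linear bfs_sort -> (X -> R[i]^o)};
  bfs_fun_inj : injective bfs_fun;
  bfs_fun_measurable : forall f, borel_measurable (bfs_fun f)
}.
Arguments bfs_fun {_}.

(* The element of F whose underlying function is g; junk value 0 if g is not
   in F. *)
Definition bfs_of (F : banachFunctionSpace) (g : X -> R[i]^o) : F :=
  xget 0 [set f : F | bfs_fun f = g].

(* [alinv] is the inverse of [al]. *)
Record aperiodic (al alinv : X -> X) : Prop := Aperiodic {
  aperiodicK : cancel al alinv;
  aperiodicVK : cancel alinv al;
  aperiodic_measurable : borel_measurable al;
  aperiodicV_measurable : borel_measurable alinv;
  aperiodic_disjoint : forall K : set X, compact K ->
    exists2 N, (0 < N)%N &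
      forall n, (N <= n)%N -> K `&` (iter n al @` K) = set0
}.

Definition solid (F : banachFunctionSpace) : Prop :=
  forall (f : F) (g : X -> R[i]^o), borel_measurable g ->
    (forall x, `|g x| <= `|bfs_fun f x|) ->
    exists2 h : F, bfs_fun h = g & `|h| <= `|f|.

Definition comp_invariant (F : banachFunctionSpace) (b : X -> X) : Prop :=
  forall f : F, exists2 h : F, bfs_fun h = bfs_fun f \o b & `|h| = `|f|.

Definition bounded_compact_support (F : banachFunctionSpace) : set F :=
  [set f : F | (exists M : R, forall x, `|bfs_fun f x| <= M%:C) /\
           compact (closure [set x | bfs_fun f x != 0])].

Record condition_Omega (F : banachFunctionSpace) (al alinv : X -> X) : Prop :=
  ConditionOmega {
  Omega_solid : solid F;
  Omega_invariant : comp_invariant F al;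
  Omega_invariantV : comp_invariant F alinv;
  Omega_indic : forall E : set X, compact E ->
    exists f : F, bfs_fun f = \1_E;
  Omega_dense : dense (@bounded_compact_support F)
}.

Definition weight (w : X -> R) : Prop :=
  [/\ borel_measurable w, (forall x, 0 < w x) &
      exists M : R, forall x, w x <= M].

Section Operators.
Variables (F : banachFunctionSpace) (al alinv : X -> X) (w : X -> R).

Definition wcomp_op (f : F) : F :=
  bfs_of F (fun x => (w x)%:C * bfs_fun f (al x)).

Definition wcomp_op_inv (f : F) : F :=
  bfs_of F (fun x => bfs_fun f (alinv x) / (w (alinv x))%:C).

Definition cosine_op (n : nat) (f : F) : F :=
  2^-1 *: (iter n wcomp_op f + iter n wcomp_op_inv f).

End Operators.

End Spaces.
Arguments bfs_fun {_ _ _}.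

Lemma borel_measurable_open (X Y : topologicalType) (f : X -> Y) :
  (forall U : set Y, open U -> <<s open >> (f @^-1` U)) -> borel_measurable f.
Proof.
move=> fU B.
apply: (@smallest_sub _ (sigma_algebra setT) (@open Y)
  [set B | <<s open >> (f @^-1` B)]) => //.
split => /=.
- by rewrite preimage_set0; exact: sigma_algebra0.
- move=> A fA; rewrite setTD preimage_setC -setTD.
  exact: sigma_algebraCD.
- by move=> A fA; rewrite preimage_bigcup; exact: sigma_algebra_bigcup.
Qed.

Lemma borel_setI (X : topologicalType) (A B : set X) :
  <<s open >> A -> <<s open >> B -> <<s open >> (A `&` B).
Proof.
move=> sA sB; rewrite -[_ `&` _]setCK setCI -bigcup2E -setTD.
apply: sigma_algebraCD; apply: sigma_algebra_bigcup => -[|[|n]] /=.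
- by rewrite -setTD; exact: sigma_algebraCD.
- by rewrite -setTD; exact: sigma_algebraCD.
- exact: sigma_algebra0.
Qed.

Section Spaces.
Variables (R : realType) (X : topologicalType).

Lemma normc_real (t : R) : `|t%:C| = `|t|%:C :> R[i].
Proof. by rewrite normc_def /= expr0n /= addr0 sqrtr_sqr. Qed.

Lemma borel_measurable_scale (w : X -> R) (h : X -> R[i]^o) :
  borel_measurable w -> borel_measurable h ->
  borel_measurable (fun x => (w x)%:C * h x : R[i]^o).
Proof.
move=> mw mh; apply: borel_measurable_open => U oU.
pose I (q : rat) (k : nat) : set R := ball (ratr q : R) k.+1%:R^-1.
pose V q k : set R[i]^o :=
  interior [set z : R[i]^o | forall t, I q k t -> U (t%:C * z : R[i]^o)].
have -> : (fun x => (w x)%:C * h x) @^-1` U =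
    \bigcup_k \bigcup_n
      if unpickle n is Some q then w @^-1` I q k `&` h @^-1` V q k else set0.
  apply/seteqP; split => x /=; last first.
    case=> k _ [n _]; case: (unpickle n) => [q [/= Iw]|//].
    by move=> /interior_subset; apply.
  move=> Ux.
  have := oU; rewrite openE => /(_ _ Ux); rewrite /interior.
  move=> /nbhs_ballP [e /= e0 eU].
  have [e' e'E] : exists e', e = e'%:C.
    by exists (complex.Re e); rewrite RRe_real// gtr0_real.
  have [a aE] : exists a : R, `|h x : R[i]| = a%:C.
    by exists (complex.Re `|h x : R[i]|); rewrite RRe_real// normr_real.
  have a0 : 0 <= a by rewrite -lecR -aE normr_ge0.
  have e'0 : 0 < e' by rewrite -ltcR -e'E.
  set c := `|w x| + a + 1.
  have c0 : 0 < c by rewrite /c ltr_wpDl// addr_ge0.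
  pose d := Num.min 1 (e' / (2 * c)).
  have d0 : 0 < d by rewrite lt_min ltr01/= divr_gt0// mulr_gt0.
  have d1 : d <= 1 by rewrite ge_min lexx.
  have dc : d * c < e'.
    rewrite (@le_lt_trans _ _ (e' / (2 * c) * c))//.
      by rewrite ler_pM2r// ge_min lexx orbT.
    rewrite invfM mulrA mulfVK ?gt_eqF// ltr_pdivrMr// mulr_natr mulr2n.
    by rewrite ltrDl.
  have de (t : R) (z : R[i]) : `|w x - t| < d -> `|(h x : R[i]) - z| < d%:C ->
      `|(w x)%:C * (h x : R[i]) - t%:C * z| < e.
    move=> wt hz.
    have -> : (w x)%:C * (h x : R[i]) - t%:C * z =
        t%:C * ((h x : R[i]) - z) + (w x - t)%:C * (h x : R[i]).
      by rewrite raddfB /= mulrBr mulrBl [RHS]addrC addrA subrK.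
    rewrite (le_lt_trans (ler_normD _ _))// !normrM !normc_real aE.
    rewrite (@le_lt_trans _ _ (`|t|%:C * d%:C + `|w x - t|%:C * a%:C))//.
      by rewrite lerD2r ler_wpM2l ?(ltW hz)// (lecR 0) normr_ge0.
    rewrite -!rmorphM -rmorphD /= e'E ltcR (le_lt_trans _ dc)//.
    have t1 : `|t| <= `|w x| + 1.
      rewrite -(subrK (w x) t) addrC (le_trans (ler_normD _ _))// lerD2l.
      by rewrite distrC (le_trans (ltW wt)).
    have -> : d * c = (`|w x| + 1) * d + d * a by rewrite /c; ring.
    by rewrite lerD// ler_wpM2r// ltW.
  have [k kd] : exists k : nat, k.+1%:R^-1 < d / 2.
    have [|k] := @ltr_add_invr R 0 (d / 2); first by rewrite divr_gt0.
    by rewrite add0r; exists k.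
  have [q qw] : exists q : rat, `|ratr q - w x| < k.+1%:R^-1.
    have [|q] := @rat_in_itvoo R (w x) (w x + k.+1%:R^-1).
      by rewrite ltrDl invr_gt0.
    rewrite in_itv/= => /andP[q1 q2]; exists q.
    by rewrite gtr0_norm ?subr_gt0// ltrBlDl.
  exists k; first exact: Logic.I.
  exists (pickle q); first exact: Logic.I.
  rewrite pickleK; split; first exact: qw.
  rewrite /V /interior /=.
  apply/nbhs_ballP; exists d%:C; first by rewrite /= ltcR.
  move=> z hz t It; apply: eU; apply: de => //.
  rewrite (splitr d) (le_lt_trans (ler_distD (ratr q) _ _))// ltrD//.
    by rewrite distrC (lt_trans qw).
  by rewrite (lt_trans It).
apply: sigma_algebra_bigcup => k; apply: sigma_algebra_bigcup => n.
case: unpickle => [q|]; last exact: sigma_algebra0.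
apply: borel_setI.
  by apply: mw; apply: sub_sigma_algebra; exact: ball_open.
by apply: mh; apply: sub_sigma_algebra; exact: open_interior.
Qed.

(* Under the standing hypotheses no junk value of [bfs_of] is ever taken. *)
Lemma bfs_ofE (F : banachFunctionSpace R X) (g : X -> R[i]^o) :
  (exists f : F, bfs_fun f = g) -> bfs_fun (bfs_of F g) = g.
Proof. by case=> f fg; rewrite /bfs_of; case: xgetP => [_ -> //|/(_ f)]. Qed.

Lemma solid_weight (F : banachFunctionSpace R X) (v : X -> R) (f : F) :
  solid F -> weight v ->
  exists h : F, bfs_fun h = (fun x => (v x)%:C * bfs_fun f x).
Proof.
move=> sF [mv v0 [M vM]].
have [|x|h hE _] := sF (M%:C *: f) (fun x => (v x)%:C * bfs_fun f x).
- by apply: borel_measurable_scale => //; exact: bfs_fun_measurable.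
- have M0 : 0 <= M by exact: le_trans (ltW (v0 x)) (vM x).
  rewrite linearZ /= normrM [leRHS]normrM !normc_real.
  by rewrite ler_wpM2r// lecR !ger0_norm// ltW.
- by exists h.
Qed.

Section OperatorsE.
Variables (F : banachFunctionSpace R X) (al alinv : X -> X) (w : X -> R).
Hypotheses (al_aper : aperiodic al alinv) (FO : condition_Omega F al alinv).
Hypotheses (w_weight : weight w) (winv_weight : weight (fun x => (w x)^-1)).

Lemma wcomp_opE (f : F) :
  bfs_fun (wcomp_op al w f) = (fun x => (w x)%:C * bfs_fun f (al x)).
Proof.
have [h hE _] := Omega_invariant FO f.
have [g gE] := solid_weight h (Omega_solid FO) w_weight.
by apply: bfs_ofE; exists g; rewrite gE hE.
Qed.

Lemma wcomp_op_invE (f : F) : bfs_fun (wcomp_op_inv alinv w f) =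
  (fun x => bfs_fun f (alinv x) / (w (alinv x))%:C).
Proof.
have [g gE] := solid_weight f (Omega_solid FO) winv_weight.
have [h hE _] := Omega_invariantV FO g.
apply: bfs_ofE; exists h; rewrite hE gE; apply/funext => x /=.
by rewrite mulrC; congr (_ * _); rewrite fmorphV.
Qed.

Let w_neq0 x : (w x)%:C != 0 :> R[i].
Proof. by case: w_weight => _ w0 _; rewrite fmorph_eq0 gt_eqF. Qed.

Lemma wcomp_opK : cancel (@wcomp_op _ _ F al w) (wcomp_op_inv alinv w).
Proof.
move=> f; apply: bfs_fun_inj; rewrite wcomp_op_invE wcomp_opE.
apply/funext => x; rewrite (aperiodicVK al_aper) mulrC.
exact: mulKf.
Qed.

Lemma wcomp_op_invK : cancel (wcomp_op_inv alinv w) (@wcomp_op _ _ F al w).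
Proof.
move=> f; apply: bfs_fun_inj; rewrite wcomp_opE wcomp_op_invE.
apply/funext => x; rewrite (aperiodicK al_aper) mulrC.
exact: divfK.
Qed.

End OperatorsE.
End Spaces.

(* Main.v *)
(* If inf w > 1 then the inverse S of the weighted composition operator T
   contracts norms by a factor c < 1, so ||T^n f|| >= c^-n ||f||.  A periodic
   element f satisfies T^n f = 2 f - S^n f, of norm at most 3 ||f||, for
   arbitrarily large n; hence f = 0, and the periodic elements are not dense.
   If sup w < 1 the same argument applies with T and S exchanged. *)
Require Import Defs.
From mathcomp Require Import all_boot all_order all_algebra.
From mathcomp Require Import all_classical all_reals all_analysis.

Import Order.TTheory GRing.Theory Num.Theory.
Import numFieldNormedType.Exports.

Local Open Scope classical_set_scope.
Local Open Scope ring_scope.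
Local Open Scope complex_scope.

Lemma iter_contraction (R : realType) (V : normedModType R[i]) (B : V -> V)
    (c : R) (n : nat) (y : V) :
  0 <= c -> (forall x, `|B x| <= c%:C * `|x|) ->
  `|iter n B y| <= (c ^+ n)%:C * `|y|.
Proof.
move=> c0 Bc; elim: n => [|n IH]; first by rewrite expr0 mul1r.
rewrite iterS (le_trans (Bc _))// exprS rmorphM -mulrA ler_wpM2l//.
by rewrite (lecR 0).
Qed.

(** Since $B^nA^nx=x$, one gets $\|x\|\le c^n\|A^nx\|\le 3c^n\|x\|$ for large multiples $n$ of [N].
    Keeping [A] and [B] abstract allows the operator and its inverse to be exchanged. *)
Lemma cosine_periodic_eq0 (R : realType) (V : normedModType R[i])
    (A B : V -> V) (c : R) (N : nat) (x : V) :
  0 <= c < 1 -> cancel A B -> (forall y, `|B y| <= c%:C * `|y|) ->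
  (0 < N)%N ->
  (forall k, (0 < k)%N ->
    2^-1 *: (iter (k * N) A x + iter (k * N) B x) = x) ->
  x = 0.
Proof.
move=> /andP[c0 c1] AK Bc N0 px.
have iterAK n y : iter n B (iter n A y) = y.
  by elim: n y => // n IH y; rewrite iterSr iterS AK IH.
have /cvgrPdist_lt cc : c ^+ n @[n --> \oo] --> 0
  by apply: cvg_expr; rewrite ger0_norm.
have [|m _ mc] := cc 3^-1; first by rewrite invr_gt0.
(* A positive multiple of [N], as periodicity requires, that is at least [m]. *)
set n := (m.+1 * N)%N.
have cn : c ^+ n < 3^-1.
  have /mc : (m <= n)%N by rewrite (leq_trans (leqnSn m))// leq_pmulr.
  by rewrite /= sub0r normrN ger0_norm// exprn_ge0.
have Anx : iter n A x = 2 *: x - iter n B x.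
  by rewrite -[in 2 *: x](px m.+1)// scalerA divff// scale1r addrK.
have Bnx : `|iter n B x| <= `|x|.
  rewrite (le_trans (iter_contraction _ _ _ _ _ _ c0 Bc))// ler_piMl//.
  by rewrite (lecR _ 1) exprn_ile1// ltW.
have An3 : `|iter n A x| <= 3 * `|x|.
  rewrite Anx (le_trans (ler_normB _ _))// normrZ normr_nat.
  by rewrite -(@natr1 _ 2) [leRHS]mulrDl mul1r lerD2l.
have : `|x| <= (c ^+ n * 3)%:C * `|x|.
  rewrite -{1}(iterAK n x) (le_trans (iter_contraction _ _ _ _ _ _ c0 Bc))//.
  rewrite rmorphM -mulrA ler_wpM2l ?(lecR 0) ?exprn_ge0//.
  by rewrite rmorph_nat.
(* For $x\ne0$, dividing by $\|x\|$ would give $1\le 3c^n$, against [cn]. *)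
have [//|x0] := eqVneq x 0.
rewrite ler_pMl ?normr_gt0// (lecR 1) leNgt.
by rewrite -(ltr_pdivlMr _ _ (ltr0Sn _ 2)) mul1r cn.
Qed.

(** The image of $f$ is dominated pointwise by $c\,|f\circ\alpha^{-1}|$; solidity turns this into a
    norm bound, and invariance gives $\|f\circ\alpha^{-1}\|=\|f\|$. *)
Lemma wcomp_op_inv_contraction (R : realType) (X : topologicalType)
    (al alinv : X -> X) (F : banachFunctionSpace R X) (w : X -> R) (c : R) :
  condition_Omega F al alinv -> weight (fun x => (w x)^-1) ->
  (forall x, (w x)^-1 <= c) -> 0 <= c ->
  forall f : F, `|wcomp_op_inv alinv w f| <= c%:C * `|f|.
Proof.
move=> FO wv wc c0 f.
have solidF := Omega_solid FO.
have [h hE hN] := Omega_invariantV FO f.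
have [||g gE gN] := solidF (c%:C *: h) (bfs_fun (wcomp_op_inv alinv w f)).
- exact: bfs_fun_measurable.
- move=> x; rewrite (wcomp_op_invE FO wv) linearZ /= hE /=.
  rewrite mulrC -fmorphV !normrM !normc_real ler_wpM2r// lecR !ger0_norm//.
  by case: wv => _ + _; move=> /(_ (alinv x))/ltW.
by rewrite -(bfs_fun_inj gE) (le_trans gN)// normrZ normc_real ger0_norm// hN.
Qed.

Lemma wcomp_op_contraction (R : realType) (X : topologicalType)
    (al alinv : X -> X) (F : banachFunctionSpace R X) (w : X -> R) (c : R) :
  condition_Omega F al alinv -> weight w ->
  (forall x, w x <= c) -> 0 <= c ->
  forall f : F, `|wcomp_op al w f| <= c%:C * `|f|.
Proof.
move=> FO ww wc c0 f.
have solidF := Omega_solid FO.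
have [h hE hN] := Omega_invariant FO f.
have [||g gE gN] := solidF (c%:C *: h) (bfs_fun (wcomp_op al w f)).
- exact: bfs_fun_measurable.
- move=> x; rewrite (wcomp_opE FO ww) linearZ /= hE /=.
  rewrite !normrM !normc_real ler_wpM2r// lecR !ger0_norm//.
  by case: ww => _ + _; move=> /(_ x)/ltW.
by rewrite -(bfs_fun_inj gE) (le_trans gN)// normrZ normc_real ger0_norm// hN.
Qed.

Theorem corollary3p5 (R : realType) (X : topologicalType) (al alinv : X -> X)
    (F : banachFunctionSpace R X) (w : X -> R) (K : set X)
    (Fsep : separable F) (Finf : infinite_dimensional F)
    (al_aper : aperiodic al alinv)
    (Omega : condition_Omega F al alinv)
    (Kcompact : compact K) (Kpos : 0 < `|bfs_of F \1_K|)
    (w_weight : weight w) (winv_weight : weight (fun x => (w x)^-1)) :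
  chaotic (cosine_op al alinv w : nat -> F -> F) ->
  inf (range w) <= 1 <= sup (range w).
Proof.
move=> [_ Pdense].
have [f [N N0 fper] f0] : exists2 f : F,
    periodic_elements (cosine_op al alinv w) f & f != 0.
  (* The complement of $\{0\}$ is open, and it contains $\chi_K$ by [Kpos], so it meets the dense
     set of periodic elements. *)
  have [||f [/eqP f0 fP]] := Pdense (~` [set 0]).
  - by exists (bfs_of F \1_K) => /= K0; rewrite K0 normr0 ltxx in Kpos.
  - rewrite openC; apply: accessible_closed_set1.
    exact/hausdorff_accessible/norm_hausdorff.
  by exists f.
have w0 x : 0 < w x by case: w_weight.
have [_ _ [M wM]] := w_weight.
apply/andP; split; rewrite leNgt; apply: contra_neqN f0 => w1.
(* If $\inf w>1$, then $1/w\le 1/\inf w<1$, so the inverse operator contracts. *)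
- apply: (@cosine_periodic_eq0 _ _ (wcomp_op al w) (wcomp_op_inv alinv w)
    (inf (range w))^-1 N) => //.
  + by rewrite invr_ge0 invf_lt1 ?w1 ?ltW// (lt_trans _ w1).
  + exact: (wcomp_opK al_aper Omega w_weight winv_weight).
  + apply: (@wcomp_op_inv_contraction _ _ al) => //.
      move=> x; rewrite lef_pV2 ?posrE ?(lt_trans _ w1)//.
      by apply: ge_inf => //; exists 0 => _ [y _ <-]; rewrite ltW.
    by rewrite invr_ge0 ltW// (lt_trans _ w1).
- have wsup x : w x <= sup (range w).
    by apply: ub_le_sup => //; exists M => _ [y _ <-].
  have sup0 : 0 <= sup (range w).
    (* For empty [X] the supremum takes its default value 0. *)
    have [->|/set0P[_ [x _ _]]] := eqVneq (range w) set0.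
      by rewrite sup0.
    by rewrite (le_trans (ltW (w0 x))).
  apply: (@cosine_periodic_eq0 _ _ (wcomp_op_inv alinv w) (wcomp_op al w)
    (sup (range w)) N) => //.
  + by rewrite sup0.
  + exact: (wcomp_op_invK al_aper Omega w_weight winv_weight).
  + exact: (@wcomp_op_contraction _ _ al alinv).
  (* The two summands of the cosine operator are swapped to match the exchanged roles. *)
  + by move=> k k0; rewrite addrC; exact: fper.
Qed.
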